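(* Let $\lambda,\lambda_s,\mu,R,C>0$ with $\lambda+\lambda_s<\mu$ and $R\ge C/\mu$. In the partially observable mean field model there is a unique joining probability $q^*\in[0,1]$ of the dedicated customers that maximizes over $q\in[0,1]$ the social benefits per time unit $$S_{soc}(q)=(\lambda q+\lambda_s)R-C\,E(L(q)),$$ and it is given by $$q^*=\begin{cases}0, & R\le C\dfrac{\lambda_s+\mu}{\mu^2},\\[2mm] \dfrac{\mu}{\lambda}-\dfrac1\lambda\sqrt{\dfrac{C(\lambda_s+\mu)}{R}}, & C\dfrac{\lambda_s+\mu}{\mu^2}<R<C\dfrac{\lambda_s+\mu}{(\mu-\lambda)^2},\\[2mm] 1, & R\ge C\dfrac{\lambda_s+\mu}{(\mu-\lambda)^2}.\end{cases}$$
   Context: Finite model: there are $N$ parallel queues, each with infinite waiting space and one server with exponential service rate $\mu$. Each queue has its own dedicated Poisson arrival stream of rate $\lambda$; an additional Poisson stream of rate $N\lambda_s$ brings ''smart'' customers, who each join a shortest queue. ''Partially observable'' means that dedicated customers do not observe the numbers of customers in the queues, while smart customers do. Smart customers always enter. A strategy of the dedicated customers is a joining probability $q\in[0,1]$. Mean field model ($N\to\infty$) when dedicated customers use $q$: a single-server queue with exponential service rate $\mu$, Poisson dedicated arrivals of rate $\lambda q$, and extra (smart) arrivals that occur only when the queue is empty, at rate $\lambda_s/\pi_0$, where $\pi_0$ is the stationary probability that the queue is empty. Its stationary queue-length distribution is $\pi_0=1-\rho$, $\pi_k=\rho(1-\sigma)\sigma^{k-1}$ for $k\ge1$, with $\rho=(\lambda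 q+\lambda_s)/\mu$ and $\sigma=\lambda q/\mu$. The expected stationary queue length is $E(L(q))=\sum_{k\ge0}k\pi_k=\rho/(1-\sigma)$. Each customer receives reward $R$ after service and pays waiting cost $C$ per unit time in the system; hence the social benefits per time unit, when all dedicated customers join with probability $q$, are $S_{soc}(q)$ as in the claim. *)

(* Defs.v *)
From Stdlib Require Import Reals Lra Lia.
From Coquelicot Require Import Coquelicot.
Open Scope R_scope.

(* The extra arrivals at an empty queue have rate [lambda_s / pi_0], where
   [pi_0] is itself the stationary probability of being empty: the rate
   therefore depends on the distribution [p] under consideration. *)
Definition arrival_rate (lambda lambda_s q : R) (p : nat -> R) (k : nat) : R :=
  match k with
  | O => lambda * q + lambda_s / p 0%nat
  | S _ => lambda * q
  end.

(* Probability distributions satisfying the global balance equations of the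
   mean field birth-death chain. Positivity of [p 0] is what makes the rate
   [lambda_s / p 0] meaningful. *)
Record mf_stationary (lambda lambda_s mu q : R) (p : nat -> R) : Prop := {
  mf_nonneg : forall k, 0 <= p k;
  mf_total : is_series p 1;
  mf_empty_pos : 0 < p 0%nat;
  mf_balance_0 : arrival_rate lambda lambda_s q p 0 * p 0%nat = mu * p 1%nat;
  mf_balance_S : forall k,
    (arrival_rate lambda lambda_s q p (S k) + mu) * p (S k)
    = arrival_rate lambda lambda_s q p k * p k + mu * p (S (S k))
}.

Definition mean_queue_length (p : nat -> R) : R :=
  Series (fun k => INR k * p k).

(* [Rw] is the reward, since [R] denotes the type of real numbers. *)
Definition S_soc (lambda lambda_s Rw C : R) (pi : R -> nat -> R) (q : R) : R :=
  (lambda * q + lambda_s) * Rw - C * mean_queue_length (pi q).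

Definition is_maximizer_01 (f : R -> R) (q : R) : Prop :=
  0 <= q <= 1 /\ forall q', 0 <= q' <= 1 -> f q' <= f q.

Definition mf_pi (lambda lambda_s mu q : R) (k : nat) : R :=
  let rho := (lambda * q + lambda_s) / mu in
  let sigma := lambda * q / mu in
  match k with
  | O => 1 - rho
  | S j => rho * (1 - sigma) * sigma ^ j
  end.

(* [mf_stationary] is inhabited, and only by the known distribution. *)
Lemma mf_pi_stationary (lambda lambda_s mu q : R) :
  0 < lambda -> 0 < lambda_s -> lambda + lambda_s < mu -> 0 <= q <= 1 ->
  mf_stationary lambda lambda_s mu q (mf_pi lambda lambda_s mu q).
Proof.
intros Hl Hs Hm Hq.
assert (Hlq : 0 <= lambda * q <= lambda) by nra.
assert (Hmu : 0 < mu) by lra.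
assert (H1 : 0 <= lambda * q / mu < 1).
{ split; [apply Rdiv_le_0_compat; lra|].
  apply (Rmult_lt_reg_r mu); [lra|]. field_simplify; lra. }
assert (H2 : 0 < (lambda * q + lambda_s) / mu < 1).
{ split; [apply Rdiv_lt_0_compat; lra|].
  apply (Rmult_lt_reg_r mu); [lra|]. field_simplify; lra. }
assert (H3 : mu - (lambda * q + lambda_s) <> 0) by lra.
split.
- intros [|k]; unfold mf_pi; [lra|].
  apply Rmult_le_pos; [nra | apply pow_le; lra].
- apply is_series_decr_1.
  match goal with |- is_series _ ?l =>
    replace l with (scal ((lambda * q + lambda_s) / mu * (1 - lambda * q / mu))
                         (/ (1 - lambda * q / mu))) end.
  + unfold mf_pi.
    apply (is_series_scal _ (fun k => (lambda * q / mu) ^ k)).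
    apply is_series_geom. rewrite Rabs_pos_eq; lra.
  + unfold scal, plus, opp; simpl; unfold mult; simpl. field. lra.
- unfold mf_pi; lra.
- unfold arrival_rate, mf_pi; simpl. field. lra.
- intros [|k]; unfold arrival_rate, mf_pi; simpl; field; lra.
Qed.

Lemma mf_stationary_eq (lambda lambda_s mu q : R) (p : nat -> R) :
  0 < lambda -> 0 < lambda_s -> lambda + lambda_s < mu -> 0 <= q <= 1 ->
  mf_stationary lambda lambda_s mu q p ->
  forall k, p k = mf_pi lambda lambda_s mu q k.
Proof.
intros Hl Hs Hm Hq [_ Ht H0 Hb0 HbS].
assert (Hlq : 0 <= lambda * q <= lambda) by nra.
assert (Hmu : 0 < mu) by lra.
assert (H1 : 0 <= lambda * q / mu < 1).
{ split; [apply Rdiv_le_0_compat; lra|].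
  apply (Rmult_lt_reg_r mu); [lra|]. field_simplify; lra. }
assert (Hcut : forall k, arrival_rate lambda lambda_s q p k * p k = mu * p (S k)).
{ induction k as [|k IH]; [exact Hb0|]. specialize (HbS k). nra. }
assert (Hgeo : forall k, p (S k) = p 1%nat * (lambda * q / mu) ^ k).
{ induction k as [|k IH]; [simpl; ring|].
  apply (Rmult_eq_reg_l mu); [|lra].
  rewrite <- (Hcut (S k)), IH. simpl. field. lra. }
assert (Hp1 : lambda * q * p 0%nat + lambda_s = mu * p 1%nat).
{ rewrite <- Hb0. simpl. field. lra. }
assert (Hsum : p 1%nat * / (1 - lambda * q / mu) = 1 - p 0%nat).
{ assert (Ha : is_series (fun k => p (S k)) (1 - p 0%nat)).
  { apply is_series_incr_1.
    change (is_series p ((1 - p 0%nat) + p 0%nat)%R).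
    replace ((1 - p 0%nat) + p 0%nat) with 1 by ring. exact Ht. }
  assert (Hb : is_series (fun k => p (S k)) (p 1%nat * / (1 - lambda * q / mu))).
  { apply (is_series_ext (fun k => scal (p 1%nat) ((lambda * q / mu) ^ k))).
    - intros k. symmetry. exact (Hgeo k).
    - apply (is_series_scal (p 1%nat) (fun k => (lambda * q / mu) ^ k)).
      apply is_series_geom. rewrite Rabs_pos_eq; lra. }
  rewrite <- (is_series_unique _ _ Ha), <- (is_series_unique _ _ Hb). reflexivity. }
assert (E1 : p 1%nat = (1 - p 0%nat) * (1 - lambda * q / mu)).
{ rewrite <- Hsum. field. lra. }
assert (E0 : p 0%nat = 1 - (lambda * q + lambda_s) / mu).
{ assert (mu * p 1%nat = (1 - p 0%nat) * (mu - lambda * q)).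
  { rewrite E1. field. lra. }
  apply (Rmult_eq_reg_l mu); [|lra].
  replace (mu * (1 - (lambda * q + lambda_s) / mu))
    with (mu - (lambda * q + lambda_s)) by (field; lra).
  nra. }
intros [|k]; unfold mf_pi; [exact E0|].
rewrite Hgeo, E1, E0. ring.
Qed.

(* Main.v *)
Require Import Defs.
From Stdlib Require Import Reals Lra Lia.
From Coquelicot Require Import Coquelicot.
Open Scope R_scope.

(** In the variable [y = mu - lambda * q], the spare service capacity left by
    the dedicated customers, the mean queue length [rho / (1 - sigma)] is
    [(lambda_s + mu) / y - 1], so with [s = sqrt (C * (lambda_s + mu) / Rw)]

      [S_soc q = constant - Rw * (y + s ^ 2 / y)].

    Maximizing the social benefits over [q] in [[0, 1]] therefore means
    minimizing [y + s ^ 2 / y] over [y] in [[mu - lambda, mu]]. That function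
    decreases strictly before [s] and increases strictly after it, so its only
    minimizer is the point of the interval closest to [s]
    ([add_sqr_div_lt_closest]). The three regimes of the reward are the three
    positions of [s] with respect to the interval, [mu <= s],
    [mu - lambda < s < mu] and [s <= mu - lambda].

    The formula for the mean queue length comes from the uniqueness of the
    stationary distribution ([mf_stationary_eq]) and from the differentiated
    geometric series ([is_series_succ_pow]). *)

(** This is the Cauchy square of the geometric series: the coefficient of
    [x ^ n] in it counts the [n + 1] ways of writing [n = k + (n - k)]. *)
Lemma is_series_succ_pow (x : R) :
  Rabs x < 1 -> is_series (fun k => INR (S k) * x ^ k) (/ (1 - x) ^ 2).
Proof.
intros Hx.
assert (Habs : ex_series (fun k => Rabs (x ^ k))).
{ apply (ex_series_ext (fun k => Rabs x ^ k)).
  - intros k. apply RPow_abs.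
  - apply ex_series_geom. rewrite Rabs_Rabsolu. exact Hx. }
assert (Hx1 : x < 1) by (apply Rabs_def2 in Hx; lra).
replace (/ (1 - x) ^ 2) with (/ (1 - x) * / (1 - x)) by (field; lra).
apply (is_series_ext
  (fun n => sum_f_R0 (fun k => x ^ k * x ^ (n - k)) n)).
- intros n. rewrite (sum_eq _ (fun _ => x ^ n)).
  + rewrite sum_cte. apply Rmult_comm.
  + intros k Hk. rewrite <- pow_add. f_equal. lia.
- apply is_series_mult; try assumption; apply is_series_geom; exact Hx.
Qed.

Lemma mean_queue_length_mf_stationary (lambda lambda_s mu q : R) (p : nat -> R) :
  0 < lambda -> 0 < lambda_s -> lambda + lambda_s < mu -> 0 <= q <= 1 ->
  mf_stationary lambda lambda_s mu q p ->
  mean_queue_length p = (lambda * q + lambda_s) / (mu - lambda * q).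
Proof.
intros Hl Hs Hm Hq Hp.
assert (Hlq : 0 <= lambda * q <= lambda) by nra.
set (rho := (lambda * q + lambda_s) / mu).
set (sigma := lambda * q / mu).
assert (Hsigma : 0 <= sigma < 1).
{ unfold sigma. split.
  - apply Rdiv_le_0_compat; lra.
  - apply Rlt_div_l; lra. }
unfold mean_queue_length. apply is_series_unique.
(* The empty queue contributes 0, which leaves a sum over [S k]. *)
apply is_series_decr_1.
apply (is_series_ext
  (fun k => scal (rho * (1 - sigma)) (INR (S k) * sigma ^ k))).
{ intros k.
  rewrite (mf_stationary_eq _ _ _ _ _ Hl Hs Hm Hq Hp (S k)).
  unfold mf_pi. fold rho. fold sigma.
  change (rho * (1 - sigma) * (INR (S k) * sigma ^ k) =
          INR (S k) * (rho * (1 - sigma) * sigma ^ k)).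
  ring. }
replace (plus _ _) with (scal (rho * (1 - sigma)) (/ (1 - sigma) ^ 2)).
- apply (is_series_scal (rho * (1 - sigma))
    (fun k => INR (S k) * sigma ^ k)).
  apply is_series_succ_pow. rewrite Rabs_pos_eq; lra.
- unfold scal, plus, opp; simpl; unfold mult; simpl.
  unfold rho, sigma. field. lra.
Qed.

(** With [y = mu - lambda * q], the effective arrival rate is
    [lambda * q + lambda_s = (lambda_s + mu) - y]. It is the reward rate per
    unit of [Rw], and divided by [y] it is the mean queue length. *)
Lemma S_soc_spare_capacity (lambda lambda_s mu Rw C : R) (pi : R -> nat -> R)
    (q : R) :
  0 < lambda -> 0 < lambda_s -> lambda + lambda_s < mu -> 0 < Rw -> 0 < C ->
  0 <= q <= 1 -> mf_stationary lambda lambda_s mu q (pi q) ->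
  S_soc lambda lambda_s Rw C pi q =
  (lambda_s + mu) * Rw + C
  - Rw * ((mu - lambda * q)
          + sqrt (C * (lambda_s + mu) / Rw) ^ 2 / (mu - lambda * q)).
Proof.
intros Hl Hs Hm HR HC Hq Hp.
assert (Hlq : 0 <= lambda * q <= lambda) by nra.
unfold S_soc.
rewrite (mean_queue_length_mf_stationary lambda lambda_s mu q); try assumption.
rewrite pow2_sqrt.
- field. lra.
- apply Rdiv_le_0_compat; nra.
Qed.

(** The hypotheses on [m] say that [m] lies between [s] and [y], as the
    point closest to [s] does in any interval that contains [y]. The reason is
    the factorization
    [(y + s ^ 2 / y) - (m + s ^ 2 / m) = (y - m) * (y * m - s ^ 2) / (y * m)]:
    the two factors of its numerator have the same sign, because [y * m] lies
    strictly on the same side of [m ^ 2] as [y] of [m], and [s ^ 2] does not. *)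
Lemma add_sqr_div_lt_closest (s m y : R) :
  0 <= s -> 0 < m -> 0 < y -> y <> m ->
  (m < y -> s <= m) -> (y < m -> m <= s) ->
  m + s ^ 2 / m < y + s ^ 2 / y.
Proof.
intros Hs Hm Hy Hne Hup Hdown.
assert (Hfactor : y + s ^ 2 / y - (m + s ^ 2 / m) =
                  (y - m) * (y * m - s ^ 2) / (y * m)) by (field; lra).
assert (0 < (y - m) * (y * m - s ^ 2) / (y * m)); [|lra].
apply Rdiv_lt_0_compat; [|nra].
destruct (Rdichotomy _ _ Hne) as [Hlt | Hgt].
- specialize (Hdown Hlt).
  assert (y * m < m ^ 2) by nra.
  assert (m ^ 2 <= s ^ 2) by nra.
  nra.
- specialize (Hup Hgt).
  assert (m ^ 2 < y * m) by nra.
  assert (s ^ 2 <= m ^ 2) by nra.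
  nra.
Qed.

Lemma unique_maximizer_01_of_lt (f : R -> R) (q : R) :
  0 <= q <= 1 -> (forall q', 0 <= q' <= 1 -> q' <> q -> f q' < f q) ->
  unique (is_maximizer_01 f) q.
Proof.
intros Hq Hlt. split.
- split; [exact Hq|]. intros q' Hq'.
  destruct (Req_dec q' q) as [-> | Hne]; [lra|].
  left. now apply Hlt.
- intros q' [Hq' Hmax].
  destruct (Req_dec q' q) as [-> | Hne]; [reflexivity|].
  specialize (Hlt q' Hq' Hne). specialize (Hmax q Hq). lra.
Qed.

(** Both reward thresholds have the form [a / y ^ 2] with [y] an endpoint of
    the capacity interval; the two comparisons below turn them into the
    position of [sqrt (a / r)] with respect to [y]. *)
Lemma le_sqrt_div (a r y : R) :
  0 < r -> 0 < y -> r <= a / y ^ 2 -> y <= sqrt (a / r).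
Proof.
intros Hr Hy H.
rewrite <- (sqrt_pow2 y) by lra.
apply sqrt_le_1_alt, (Rle_div_r _ _ r); [lra|].
apply Rle_div_r in H; [lra | now apply pow_lt].
Qed.

Lemma sqrt_div_le (a r y : R) :
  0 < r -> 0 < y -> a / y ^ 2 <= r -> sqrt (a / r) <= y.
Proof.
intros Hr Hy H.
rewrite <- (sqrt_pow2 y) by lra.
apply sqrt_le_1_alt, (Rle_div_l _ _ r); [lra|].
apply Rle_div_l in H; [lra | now apply pow_lt].
Qed.

Theorem theorem3p3 (lambda lambda_s mu Rw C : R) (pi : R -> nat -> R)
    (Hlambda : 0 < lambda) (Hlambda_s : 0 < lambda_s) (Hmu : 0 < mu)
    (HRw : 0 < Rw) (HC : 0 < C)
    (Hstable : lambda + lambda_s < mu) (Hreward : Rw >= C / mu)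
    (Hpi : forall q, 0 <= q <= 1 -> mf_stationary lambda lambda_s mu q (pi q)) :
  exists q_star : R,
    unique (is_maximizer_01 (S_soc lambda lambda_s Rw C pi)) q_star /\
    (Rw <= C * ((lambda_s + mu) / mu ^ 2) -> q_star = 0) /\
    (C * ((lambda_s + mu) / mu ^ 2) < Rw < C * ((lambda_s + mu) / (mu - lambda) ^ 2) ->
       q_star = mu / lambda - 1 / lambda * sqrt (C * (lambda_s + mu) / Rw)) /\
    (Rw >= C * ((lambda_s + mu) / (mu - lambda) ^ 2) -> q_star = 1).
Proof.
set (s := sqrt (C * (lambda_s + mu) / Rw)).
assert (Hs : 0 <= s) by apply sqrt_pos.
(* [m] is the point of [[mu - lambda, mu]] closest to [s]. *)
set (m := Rmax (mu - lambda) (Rmin mu s)).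
assert (Hm : mu - lambda <= m <= mu /\
             (m < mu -> s <= m) /\ (mu - lambda < m -> m <= s)).
{ unfold m, Rmax, Rmin.
  destruct (Rle_dec mu s); destruct (Rle_dec _ _); lra. }
destruct Hm as (Hmrange & Hmup & Hmdown).
assert (Hqm : lambda * ((mu - m) / lambda) = mu - m) by (field; lra).
assert (Hq01 : 0 <= (mu - m) / lambda <= 1) by (split; nra).
assert (Hthreshold : forall y, C * ((lambda_s + mu) / y) = C * (lambda_s + mu) / y)
  by (intros y; unfold Rdiv; ring).
rewrite !Hthreshold.
exists ((mu - m) / lambda). split; [|split; [|split]].
- apply unique_maximizer_01_of_lt; [exact Hq01|].
  intros q Hq Hne.
  rewrite !(S_soc_spare_capacity lambda lambda_s mu) by auto.
  fold s. rewrite Hqm. replace (mu - (mu - m)) with m by ring.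
  assert (Hlq : 0 <= lambda * q <= lambda) by nra.
  assert (m + s ^ 2 / m < mu - lambda * q + s ^ 2 / (mu - lambda * q)); [|nra].
  apply add_sqr_div_lt_closest; try lra.
  intros Heq. apply Hne. rewrite <- Heq. field. lra.
- intros H. apply le_sqrt_div in H; try lra. fold s in H.
  replace m with mu by lra. field. lra.
- intros [H1 H2].
  apply Rlt_le, sqrt_div_le in H1; try lra. fold s in H1.
  apply Rlt_le, le_sqrt_div in H2; try lra. fold s in H2.
  replace m with s by lra. field. lra.
- intros H. apply Rge_le, sqrt_div_le in H; try lra. fold s in H.
  replace m with (mu - lambda) by lra. field. lra.
Qed.
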